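(* Let $n\ge 5$ and $k\ge 1$ be integers. (1) If $n$ is odd and $n\ge 2(k+2)+1$, or if $n$ is even and $n\ge 3(k+2)-1$, then $E(\mathcal{PSC}_{n,k}^{1,0})=[k+2,2(k+2)]^e$. (2) If $k$ is odd and $n\in[k+3,2(k+2)-1]^o$, then $E(\mathcal{PSC}_{n,k}^{1,0})=[k+2,n-1]^e$. (3) If $k$ is even and $n\in[k+3,2(k+2)-1]^o\setminus\{k+5,k+7\}$, then $E(\mathcal{PSC}_{n,k}^{1,0})=[k+2,n-1]^e\setminus\{k+4\}$; and for $n\in\{k+5,k+7\}$, $E(\mathcal{PSC}_{n,k}^{1,0})=[k+2,n-1]^e$. (4) If $k$ is odd and $n\in[k+5,3(k+1)]^e$, then $E(\mathcal{PSC}_{n,k}^{1,0})=[k+3,l]^e$, where $l=k+2\lfloor\frac{n-k-4}{4}\rfloor+3$ if $n-k-4=4\lfloor\frac{n-k-4}{4}\rfloor+1$, and $l=k+2\lfloor\frac{n-k-4}{4}\rfloor+5$ if $n-k-4=4\lfloor\frac{n-k-4}{4}\rfloor+3$. (5) If $k$ is even and $n\in[k+4,3k+2]^e$, then $E(\mathcal{PSC}_{n,k}^{1,0})=[k+2,n-k]^e$, but if $n-k\le k+2$ then $E(\mathcal{PSC}_{n,k}^{1,0})=\{k+2\}$. If $k$ is even and $n=3(k+1)+1$, then $E(\mathcal{PSC}_{n,k}^{1,0})=[k+2,2(k+1)]^e$.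
   Context: For $n\ge 3$, let $C_n$ be the set of $n\times n$ real matrices $A$ whose row $i$ ($1\le i\le n-1$) has a single entry $1$ in column $i+1$ and zeros elsewhere, and whose last row has all entries in $\{0,1\}$. For $A\in C_n$ put $F(A)=A+A^T$. Let $C_n^{1,0}=\{F(A): A\in C_n,\ a_{n,1}=1,\ a_{n,n}=0\}$ and $\mathcal{PSC}_n^{1,0}$ the set of primitive matrices in it (primitive: some power is entrywise positive; exponent: least such power). For $B=(b_{i,j})\in C_n^{1,0}$ let $V_1=\{i\in[1,n-1]: b_{n,i}=0\}$; for $U\subseteq[1,n]$, $m(U)$ is the largest size of a maximal block of consecutive integers contained in $U$ ($m(\emptyset)=0$). For $k\ge 0$, $\mathcal{PSC}_{n,k}^{1,0}=\{B\in\mathcal{PSC}_n^{1,0}: m(V_1)=k\}$ (equivalently, the last row of $B$ is $(1,Y,b_{n,n-1},0)$ where the binary string $Y$ of length $n-3$ has longest run of zeros of length exactly $k$). For a set $X$ of matrices, $E(X)$ is the set of exponents of its primitive members. $[a,b]$ is the set of integers between $a$ and $b$ inclusive, and $[a,b]^e$, $[a,b]^o$ are its even and odd elements respectively. *)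

(* Defs.v *)
From mathcomp Require Import all_boot all_order all_algebra.
From mathcomp Require Import classical_sets reals.

Set Implicit Arguments.
Unset Strict Implicit.
Unset Printing Implicit Defensive.

Import Order.TTheory GRing.Theory Num.Theory.

Local Open Scope classical_set_scope.
Local Open Scope ring_scope.

(* Rows, columns and subsets of [1, n] are indexed by 'I_n, so that i : 'I_n
   stands for the integer i + 1, and the last row is the one with index n.-1.
   Conditions on the entries of the last row quantify over the (for n > 0
   unique) index with that value, so that n itself can be the dimension. *)

Definition Cmx (R : realType) (n : nat) : set 'M[R]_n :=
  [set A | forall i j : 'I_n,
     if (i < n.-1)%N then A i j = (j == i.+1 :> nat)%:R
     else A i j = 0 \/ A i j = 1].

Definition Fmx (R : realType) (n : nat) (A : 'M[R]_n) : 'M[R]_n := A + A^T.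

Definition Cmx10 (R : realType) (n : nat) : set 'M[R]_n :=
  [set Fmx A | A in [set A | [/\ Cmx A,
     (forall i j : 'I_n, i = n.-1 :> nat -> j = 0%N :> nat -> A i j = 1)
   & (forall i j : 'I_n, i = n.-1 :> nat -> j = n.-1 :> nat -> A i j = 0)]]].

Definition positive_mx (R : realType) (n : nat) (A : 'M[R]_n) : Prop :=
  forall i j : 'I_n, 0 < A i j.

Definition primitive_mx (R : realType) (n : nat) (A : 'M[R]_n) : Prop :=
  exists2 e : nat, (0 < e)%N & positive_mx (A ^+ e).

Definition is_exponent (R : realType) (n : nat) (A : 'M[R]_n) (e : nat) : Prop :=
  [/\ (0 < e)%N, positive_mx (A ^+ e)
    & forall e' : nat, (0 < e')%N -> positive_mx (A ^+ e') -> (e <= e')%N].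

Definition exponents (R : realType) (n : nat) (X : set 'M[R]_n) : set nat :=
  [set e | exists B : 'M[R]_n, [/\ X B, primitive_mx B & is_exponent B e]].

Definition PSC10 (R : realType) (n : nat) : set 'M[R]_n :=
  [set B | Cmx10 B /\ primitive_mx B].

Definition V1 (R : realType) (n : nat) (B : 'M[R]_n) : {set 'I_n} :=
  [set i : 'I_n | (i < n.-1)%N
     && [forall r : 'I_n, (r == n.-1 :> nat) ==> (B r i == 0)]]%SET.

Definition block (n : nat) (W : {set 'I_n}) : bool :=
  [exists a : 'I_n, [exists b : 'I_n,
     (a <= b)%N && (W == [set i : 'I_n | (a <= i <= b)%N]%SET)]].

(* Blocks are nonempty, so max_block set0 is the empty maximum 0. *)
Definition max_block (n : nat) (U : {set 'I_n}) : nat :=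
  \max_(W : {set 'I_n} | maxset (fun W' => block W' && (W' \subset U)) W) #|W|.

Definition PSC10k (R : realType) (n k : nat) : set 'M[R]_n :=
  [set B | PSC10 B /\ max_block (V1 B) = k].

Definition evens (a b : nat) : set nat := [set x | (a <= x <= b)%N /\ ~~ odd x].

Definition odds (a b : nat) : set nat := [set x | (a <= x <= b)%N /\ odd x].

Arguments Cmx : clear implicits.
Arguments Cmx10 : clear implicits.
Arguments PSC10 : clear implicits.
Arguments PSC10k : clear implicits.

(* Main.v *)
Require Import Defs.
From mathcomp Require Import all_boot all_order all_algebra.
From mathcomp Require Import zify.
From mathcomp Require Import classical_sets reals.

(**
The graph of [F(A)] is a wheel with missing spokes and one missing rim edge: the vertices
[1, ..., n-1] form a path (the rim), and the hub [n] is joined to both ends of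
the rim and to some inner rim vertices.  The spokes cut the rim into parts, i.e.
they define a composition of [N = n - 2]; the zero blocks of the last row have
one vertex less than the parts, so the largest part is [K = k + 1].  The graph
is primitive iff some part is odd; let [p] be the least odd part.

If [M] is the largest length, over the vertices [u], of a shortest closed walk
of odd length through [u], then the exponent is [M - 1].  Indeed, let
[a], [b] (resp. [a'], [b']) be the lengths of two walks of opposite parities
from [u] (resp. [v]) to the hub, with [a + b] and [a' + b'] at most [M].  Then
[u] and [v] are joined by walks of even lengths [a + a'] and [b + b'] (or
[a + b'] and [b + a']), the shorter of which has length at most [M], hence at
most [M - 1].  Conversely a closed walk of
length [M] through [u] is obtained from a walk of length [M - 1] to a neighbour.
[M] is attained in the middle of a part: a part [L] contributes [L + 2] if it is
odd, and [L + p + 4] if it is even, or [L + p + 2] if it is even and next to a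
part equal to [p].  What remains is to find the values of the maximum of these
contributions over the compositions of [N] with largest part [K].
*)

Import Order.TTheory GRing.Theory Num.Theory.

Local Open Scope nat_scope.

(** * Walks in the graph of a composition *)

Definition pos (l : seq nat) (j : nat) : nat := sumn (take j l).

Lemma pos0 l : pos l 0 = 0.
Proof. by rewrite /pos take0. Qed.

Lemma posS l j : pos l j.+1 = pos l j + nth 0 l j.
Proof.
rewrite /pos; have [jl | lj] := ltnP j (size l).
  by rewrite (take_nth 0 jl) sumn_rcons.
by rewrite nth_default // addn0 !take_oversize // ltnW.
Qed.

Lemma pos_size l : pos l (size l) = sumn l.
Proof. by rewrite /pos take_size. Qed.

Lemma leq_pos l i j : i <= j -> pos l i <= pos l j.
Proof.
move=> /subnKC <-; elim: (j - i) => [|d IH]; first by rewrite addn0.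
by rewrite addnS posS (leq_trans IH) ?leq_addr.
Qed.

Lemma pos_le_sumn l j : pos l j <= sumn l.
Proof. by rewrite /pos -{2}(cat_take_drop j l) sumn_cat leq_addr. Qed.

Lemma nth_add_le_sumn l i j : i != j -> nth 0 l i + nth 0 l j <= sumn l.
Proof.
wlog ij : i j / i < j => [W|_].
  by case: (ltngtP i j) => // ij _; [|rewrite addnC]; apply: W; lia.
by have := leq_pos l _ _ ij; have := pos_le_sumn l j.+1; rewrite !posS; lia.
Qed.

Lemma pos_segment l r : 0 < size l -> r <= sumn l ->
  exists2 j, j < size l & pos l j <= r <= pos l j.+1.
Proof.
rewrite -pos_size; elim: (size l) => [//|m IH] _ rm.
have [rm'|mr] := leqP r (pos l m); last by exists m => //; lia.
case: m IH rm rm' => [|m] IH rm rm'.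
  by exists 0 => //; move: rm'; rewrite pos0; lia.
by have [j jm rj] := IH isT rm'; exists j => //; apply: ltnW.
Qed.

Lemma odd_part_between l i j : odd (pos l j - pos l i) ->
  exists2 a, i <= a < j & odd (nth 0 l a).
Proof.
have [|ij] := leqP j i; first by move=> /(leq_pos l); rewrite -subn_eq0 => /eqP->.
move: (ltnW ij) => /subnKC <-; elim: (j - i) => [|d IH]; first by rewrite addn0 subnn.
rewrite addnS posS => H; case Ho: (odd (nth 0 l (i + d))).
  by exists (i + d) => //; lia.
have [|a ha oa] := IH.
  by have := leq_pos l i (i + d) (leq_addr _ _); lia.
by exists a => //; lia.
Qed.

Lemma pos_rcons l x j :
  pos (rcons l x) j = if j <= size l then pos l j else sumn l + x.
Proof.
rewrite /pos; case: leqP => jl; first by rewrite -cats1 takel_cat.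
by rewrite take_oversize ?sumn_rcons // size_rcons.
Qed.

Lemma marks_parts N (P : pred nat) : P 0 -> P N -> exists l,
  [/\ forall a, a \in l -> 0 < a, sumn l = N &
      forall r, r <= N -> P r <-> exists j, pos l j = r].
Proof.
move=> P0 PN.
(* Without [P N] the claim becomes inductive: [l] stops at the last mark up to [N]. *)
have [l [l0 lN Pl Pr]] : exists l : seq nat, [/\ forall a, a \in l -> 0 < a, sumn l <= N,
    P (sumn l) & forall r, r <= N -> P r <-> exists j, pos l j = r].
  elim: N {PN} => [|N [l [l0 lN Pl Pr]]].
    exists [::]; split=> // r; rewrite leqn0 => /eqP->; split=> // _.
    by exists 0.
  case PN: (P N.+1).
    exists (rcons l (N.+1 - sumn l)); split.
    - by move=> a; rewrite mem_rcons inE => /orP[/eqP->|/l0 //]; lia.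
    - by rewrite sumn_rcons; lia.
    - by rewrite sumn_rcons subnKC // ltnW.
    - move=> r; rewrite leq_eqVlt => /orP[/eqP->|rN].
        split=> // _; exists (size l).+1.
        by rewrite pos_rcons ltnn subnKC // ltnW.
      rewrite Pr //; split=> [[j <-]|[j]].
        case: (leqP j (size l)) => jl; first by exists j; rewrite pos_rcons jl.
        exists (size l); rewrite pos_rcons leqnn /pos take_size take_oversize //.
        exact: ltnW.
      by rewrite pos_rcons; case: ifP => _ jr; [exists j | lia].
  exists l; split=> //; first exact: leqW.
  move=> r; rewrite leq_eqVlt => /orP[/eqP->|rN]; last exact: Pr.
  by rewrite PN; split=> // -[j jN]; have := pos_le_sumn l j; lia.
have lE : sumn l = N.
  by have [j jN] := (Pr N (leqnn N)).1 PN; have := pos_le_sumn l j; lia.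
by exists l.
Qed.

(* The rim is [Some 0, ..., Some (sumn l)] and the hub is [None]; for
   [j > size l] the spoke [pos l j] is again the last one, [sumn l]. *)
Inductive step (l : seq nat) : option nat -> option nat -> Prop :=
| step_up r of r < sumn l : step l (Some r) (Some r.+1)
| step_down r of r < sumn l : step l (Some r.+1) (Some r)
| step_in j : step l (Some (pos l j)) None
| step_out j : step l None (Some (pos l j)).

Inductive walk (l : seq nat) (u : option nat) : nat -> option nat -> Prop :=
| walk0 : walk l u 0 u
| walkS e v w of walk l u e v & step l v w : walk l u e.+1 w.

Definition vertex (l : seq nat) (u : option nat) : bool :=
  if u is Some r then r <= sumn l else true.

Definition all_walks (l : seq nat) (e : nat) : Prop :=
  forall u v, vertex l u -> vertex l v -> walk l u e v.

Lemma step_sym l u v : step l u v -> step l v u.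
Proof. by case=> *; constructor. Qed.

Lemma step_vertex l u v : step l u v -> vertex l v.
Proof. by case=> //= *; rewrite ?pos_le_sumn //; lia. Qed.

Lemma step_rim l r s : step l (Some r) (Some s) <->
  (r < sumn l /\ s = r.+1) \/ (s < sumn l /\ r = s.+1).
Proof.
split=> [st|[[rl ->]|[sl ->]]]; [|exact: step_up|exact: step_down].
by inversion st; [left|right].
Qed.

Lemma step_hub l r : step l (Some r) None <-> exists j, pos l j = r.
Proof. by split=> [st|[j <-]]; [inversion st; exists j | constructor]. Qed.

Lemma step_hubhub l : ~ step l None None.
Proof. by move=> st; inversion st. Qed.

Lemma walkSE l u e v : walk l u e.+1 v -> exists2 w, walk l u e w & step l w v.
Proof. by move=> w; inversion w as [|a x y ux xv]; exists x. Qed.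

Lemma walk_cat l u v w a b : walk l u a v -> walk l v b w -> walk l u (a + b) w.
Proof.
move=> uv; elim=> [|e x y _ IH xy]; first by rewrite addn0.
by rewrite addnS; apply: walkS xy.
Qed.

Lemma walk_step l u v : step l u v -> walk l u 1 v.
Proof. by move=> uv; apply: walkS uv; apply: walk0. Qed.

Lemma walk_sym l u v e : walk l u e v -> walk l v e u.
Proof.
elim=> [|a x y _ IH /step_sym/walk_step yx]; first exact: walk0.
by rewrite -add1n; apply: walk_cat yx IH.
Qed.

Lemma vertex_step l u : 0 < sumn l -> vertex l u -> exists v, step l u v.
Proof.
case: u => [r|] l0 /= rl; last by exists (Some (pos l 0)); constructor.
by case: r rl => [|r] rl; [exists (Some 1) | exists (Some r)]; constructor.
Qed.

(** Pads by going back and forth along an edge at [v]. *)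
Lemma walk_add_even l u v a b : 0 < sumn l -> vertex l v ->
  a <= b -> ~~ odd (a + b) -> walk l u a v -> walk l u b v.
Proof.
move=> l0 vl ab oab uv; have [w vw] := vertex_step _ _ l0 vl.
have -> : b = a + (b - a)./2.*2 by lia.
elim: (_./2) => [|c IH]; first by rewrite addn0.
rewrite doubleS !addnS; apply: walkS (step_sym _ _ _ vw).
exact: walkS vw.
Qed.

(** * Upper bounds: short walks between the hub and the rim *)

Lemma walk_rim l a b : a <= b <= sumn l -> walk l (Some a) (b - a) (Some b).
Proof.
move=> /andP[/subnKC <-]; rewrite addKn; elim: (b - a) => [|d IH] H.
  by rewrite addn0; apply: walk0.
rewrite addnS; apply: walkS (step_up _ _ _); last lia.
by apply: IH; lia.
Qed.

Lemma walk_hub_left l j r : pos l j <= r <= sumn l ->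
  walk l None (r - pos l j).+1 (Some r).
Proof.
move=> H; rewrite -add1n; apply: walk_cat (walk_rim _ _ _ H).
exact: walk_step (step_out _ _).
Qed.

Lemma walk_hub_right l j r : r <= pos l j ->
  walk l None (pos l j - r).+1 (Some r).
Proof.
move=> H; rewrite -add1n; apply: walk_cat (walk_sym _ _ _ _ (walk_rim _ _ _ _)).
  exact: walk_step (step_out _ _).
by rewrite H pos_le_sumn.
Qed.

(** Out by spoke [j], along the part, back by spoke [j.+1]. *)
Lemma walk_hub_loop l j : walk l None (nth 0 l j).+2 None.
Proof.
apply: walkS (step_in l j.+1).
have := walk_hub_left l j (pos l j.+1); rewrite posS addKn; apply.
by rewrite leq_addr -posS pos_le_sumn.
Qed.

Definition min_odd_part (l : seq nat) (p : nat) : Prop :=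
  [/\ p \in l, odd p & forall q, q \in l -> odd q -> p <= q].

(* One less than the length of a shortest odd closed walk through the middle of
   the [j]-th part.  The part before it is [nth 0 (0 :: l) j], and the default
   [0] at both ends never equals the odd part [p]. *)
Definition cost (l : seq nat) (p j : nat) : nat :=
  let L := nth 0 l j in
  if odd L then L.+1
  else if (nth 0 (0 :: l) j == p) || (nth 0 l j.+1 == p) then L + p + 1
  else L + p + 3.

Lemma vertex_two_walks l p c u : min_odd_part l p ->
    (forall j, j < size l -> cost l p j <= c) -> vertex l u ->
  exists a b, [/\ odd (a + b), a + b <= c.+1, walk l None a u & walk l None b u].
Proof.
move=> [pl op pmin] hc; have [jp jpl jpE] := nthP 0 pl.
have loop := walk_hub_loop l jp; rewrite jpE in loop.
have hub : odd (0 + p.+2) /\ 0 + p.+2 <= c.+1.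
  by split; [lia | move: (hc jp jpl); rewrite /cost jpE op; lia].
case: u => [r|] /= ru; last first.
  by exists 0, p.+2; case: hub; split => //; apply: walk0.
have [|j jl /andP[r1 r2]] := pos_segment l r _ ru; first by case: (l) pl.
have := hc j jl; rewrite /cost; set L := nth 0 l j => cL.
have rL : pos l j.+1 = pos l j + L by rewrite posS.
have wl : walk l None (r - pos l j).+1 (Some r).
  by apply: walk_hub_left; rewrite r1.
have wr : walk l None (pos l j.+1 - r).+1 (Some r) by apply: walk_hub_right.
have wpl := walk_cat _ _ _ _ _ _ loop wl.
have wpr := walk_cat _ _ _ _ _ _ loop wr.
case: ifP cL => oL cL.
  (* The walks over the two ends of an odd part have opposite parities and total length [L + 2]. *)
  by exists (r - pos l j).+1, (pos l j.+1 - r).+1; split=> //; lia.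
(* In an even part the nearer end is used twice, once after the loop around [p]; away from the
   middle this saves at least 2. *)
have [lt|] := ltnP (r - pos l j) (pos l j.+1 - r).
  exists (r - pos l j).+1, (p.+2 + (r - pos l j).+1); split=> //; first lia.
  by case: ifP cL => _; lia.
rewrite leq_eqVlt => /orP[/eqP mid|lt]; last first.
  exists (pos l j.+1 - r).+1, (p.+2 + (pos l j.+1 - r).+1); split=> //; first lia.
  by case: ifP cL => _; lia.
case: ifP cL => [adj|_] cL; last first.
  by exists (r - pos l j).+1, (p.+2 + (r - pos l j).+1); split=> //; lia.
(* At the middle, entering over the far end of a neighbouring part [p] changes the parity and is 2
   shorter than the loop. *)
have wadj : walk l None (r - pos l j + p).+1 (Some r).
  case/orP: adj => /eqP adj.
    case: j jl r1 r2 @L cL rL wl wr wpl wpr oL mid adj => [|i] /=; first by lia.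
    move=> il r1 r2 cL rL wl wr wpl wpr oL mid adj.
    have pi : pos l i.+1 = pos l i + p by rewrite posS adj.
    have -> : r - pos l i.+1 + p = r - pos l i by lia.
    by apply: walk_hub_left; lia.
  have pj : pos l j.+2 = pos l j.+1 + p by rewrite posS adj.
  have -> : r - pos l j + p = pos l j.+2 - r by lia.
  by apply: walk_hub_right; lia.
by exists (r - pos l j).+1, (r - pos l j + p).+1; split=> //; lia.
Qed.

Lemma all_walks_cost l p c e : min_odd_part l p -> ~~ odd c ->
  (forall j, j < size l -> cost l p j <= c) -> c <= e -> all_walks l e.
Proof.
move=> mp oc hc ce.
have l0 : 0 < sumn l.
  case: mp => pl op _; have [j jl jE] := nthP 0 pl.
  by have := pos_le_sumn l j.+1; rewrite posS jE; lia.
have ev u v : vertex l u -> vertex l v -> walk l u c v.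
  move=> ul vl; have [a [b [ab abc wa wb]]] := vertex_two_walks _ _ _ _ mp hc ul.
  have [a' [b' [ab' abc' wa' wb']]] := vertex_two_walks _ _ _ _ mp hc vl.
  have w x y : walk l None x u -> walk l None y v -> ~~ odd (x + y) ->
      x + y <= c -> walk l u c v.
    move=> wx wy oxy xyc.
    apply: walk_add_even xyc _ (walk_cat _ _ _ _ _ _ (walk_sym _ _ _ _ wx) wy) => //.
    by lia.
  (* Two of the four concatenations have even length; their total is at most [2 * c + 2], so the
     shorter is at most [c.+1], hence at most [c] since [c] is even. *)
  case E: (odd (a + a')); case: (leqP (a + a') c) => ?; case: (leqP (a + b') c) => ?;
  first [ by apply: (w a a') => //; lia | by apply: (w a b') => //; lia
        | by apply: (w b b') => //; lia | by apply: (w b a') => //; lia | lia].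
move: ce => /subnKC <-; elim: (e - c) => [|d IH] u v ul vl.
  by rewrite addn0; apply: ev.
have [w vw] := vertex_step _ _ l0 vl; rewrite addnS.
by apply: walkS (IH _ _ ul (step_vertex _ _ _ vw)) (step_sym _ _ _ vw).
Qed.

(** * Lower bounds *)

(** The distance |a - b|: one of the two truncated differences is 0. *)
Definition gap (a b : nat) : nat := (a - b) + (b - a).

Lemma odd_gap_pos l p i j : (forall q, q \in l -> odd q -> p <= q) ->
  odd (gap (pos l i) (pos l j)) -> p <= gap (pos l i) (pos l j).
Proof.
move=> pmin; wlog ij : i j / pos l j <= pos l i.
  move=> W; case: (leqP (pos l j) (pos l i)) => ij; first exact: W.
  by rewrite /gap addnC; apply: W; apply: ltnW.
rewrite /gap => H.
have [|a /andP[ja ai] oa] := odd_part_between l j i; first by lia.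
have al : a < size l.
  by rewrite ltnNge; apply/negP => al; move: oa; rewrite nth_default.
have pa : p <= nth 0 l a by rewrite pmin ?mem_nth.
have := leq_pos l _ _ ja.
by have := leq_pos l _ _ ai; rewrite posS; lia.
Qed.

(* After its last visit to the hub the walk leaves by some spoke [w]; if the
   parity of its length is not the one forced by [w], it has made before that an
   odd closed walk at the hub, of length at least [p + 2]. *)
Lemma hub_walk_bound l p e v : (forall q, q \in l -> odd q -> p <= q) ->
  walk l None e v ->
  if v is Some r then
    exists w, (~~ odd (e + (gap r (pos l w)).+1) /\ gap r (pos l w) < e)
              \/ gap r (pos l w) + p.+2 < e
  else ~~ odd e \/ p.+2 <= e.
Proof.
move=> pmin; elim=> [|{}e x y _ IH xy]; first by left.
case: xy IH => [r _|r _|j|j] /=.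
- by case=> w H; exists w; rewrite /gap in H *; lia.
- by case=> w H; exists w; rewrite /gap in H *; lia.
- by case=> w H; have := odd_gap_pos _ _ j w pmin; lia.
- by move=> H; exists j; rewrite /gap subnn; lia.
Qed.

(** The rim is a path, hence bipartite, so a walk that stays on it has the parity of the distance
    covered; any other walk is cut at its first visit to the hub. *)
Lemma walk_avoid_or_hub l r e v : walk l (Some r) e v ->
  (exists2 s, v = Some s & ~~ odd (e + gap r s)) \/
  exists a b, [/\ a + b = e, walk l None a (Some r) & walk l None b v].
Proof.
elim=> [|{}e x y wx IH xy]; first by left; exists r => //; rewrite /gap subnn.
case: IH => [[s sE H]|[a [b [<- wa wb]]]]; last first.
  by right; exists a, b.+1; split; rewrite ?addnS //; apply: walkS xy.
case: xy wx sE H => [i _|i _|j|j] wx sE H.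
- by left; exists i.+1 => //; case: sE H => <-; rewrite /gap; lia.
- by left; exists i => //; case: sE H => <-; rewrite /gap; lia.
- right; exists e.+1, 0; split; first by rewrite addn0.
    by apply: walk_sym; apply: walkS (step_in l j).
  exact: walk0.
- by [].
Qed.

(** The stretch contains an odd part, so its length could equal [p] only if it were a single part
    [p]. The bound [j <= size l] ensures that [j.-1] indexes a genuine, positive part. *)
Lemma pos_gap_gt l p i j : (forall q, q \in l -> 0 < q) ->
  (forall q, q \in l -> odd q -> p <= q) ->
  i < j -> (nth 0 l i != p) || (j <= size l) && (nth 0 l j.-1 != p) ->
  odd (pos l j - pos l i) -> p < pos l j - pos l i.
Proof.
move=> l0 pmin ij ip H.
have [a /andP[ia aj] oa] := odd_part_between l i j H.
have al : a < size l.
  by rewrite ltnNge; apply/negP => al; move: oa; rewrite nth_default.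
have pa : p <= nth 0 l a by rewrite pmin ?mem_nth.
have [ia' ja'] := (leq_pos l _ _ ia, leq_pos l _ _ aj).
have pos_part b : b < size l -> 0 < nth 0 l b by move=> bl; rewrite l0 ?mem_nth.
case/orP: ip => ip.
  have := leq_pos l _ _ ij; rewrite !posS in ja' *.
  case: (ltngtP i a) ia => // [ia|ia] _; last by rewrite -ia in pa ja' ip *; lia.
  have := leq_pos l _ _ ia; rewrite posS.
  by have := pos_part i (ltn_trans ia al); lia.
case: j ij H aj ja' ip => // j ij H aj ja' /= /andP[jl ip].
have {aj} [aj|aj] : a < j \/ a = j by lia.
  2: by rewrite aj in pa ia' ip *; rewrite posS in H *; lia.
have := leq_pos l _ _ aj; rewrite !posS.
by have := pos_part j jl; lia.
Qed.

(** The rim being bipartite, the walk meets the hub; cutting it there leaves two walks from the hub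
    to [m] of opposite parities, and one of them cannot take the shortest way. *)
Lemma odd_closed_walk_midpoint l p j e :
    (forall q, q \in l -> 0 < q) ->
    odd p -> (forall q, q \in l -> odd q -> p <= q) ->
    j < size l -> odd e ->
    let m := pos l j + (nth 0 l j)./2 in walk l (Some m) e (Some m) ->
  cost l p j < e.
Proof.
move=> l0 op pmin jl oe m wm.
have lr := posS l j; set L := nth 0 l j in m lr wm.
case: (walk_avoid_or_hub _ _ _ _ wm) => [[s [<-]]|[a [b [ab wa wb]]]].
  by rewrite /gap subnn !addn0 oe.
have out w : pos l w <= pos l j \/ pos l j.+1 <= pos l w.
  by case: (leqP w j) => ?; [left|right]; apply: leq_pos.
(* Up to a swap, [d] has the parity of the direct walk over the left end of the part, and [c] the
   other one. *)
have key c d : c + d = e -> walk l None c (Some m) -> walk l None d (Some m) ->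
   ~~ odd (d + L./2.+1) -> cost l p j < e.
  move=> cd wc wd od; rewrite /cost -/L.
  have [w Hw] := hub_walk_bound _ _ _ _ pmin wc.
  have [w' Hw'] := hub_walk_bound _ _ _ _ pmin wd.
  have [ow ow'] := (out w, out w').
  rewrite /gap /m in Hw Hw'.
  case: ifP => oL; first lia.
  case: Hw => [[H1 H2]|Hw]; last by case: ifP => _; lia.
  (* [L] is even and [c] makes no odd loop at the hub, so it leaves by a spoke [w] at odd distance
     from both ends, thus at least [p] beyond the part. *)
  have od' : odd (gap (pos l j) (pos l w)) by rewrite /gap; lia.
  have pw := odd_gap_pos _ _ _ _ pmin od'.
  case: ow => ow.
    have wj : w < j.
      by rewrite ltnNge; apply/negP => /(leq_pos l) jw; move: od'; rewrite /gap; lia.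
    case: ifP => [_|adj]; first by rewrite /gap in pw; lia.
    have := pos_gap_gt l p w j l0 pmin wj.
    have -> : nth 0 l j.-1 = nth 0 (0 :: l) j by case: (j) wj.
    rewrite (ltnW jl); move: adj; case: (_ == p); rewrite ?orbT //= => _ /(_ isT).
    by rewrite /gap in od' *; lia.
  have od2 : odd (gap (pos l w) (pos l j.+1)) by rewrite /gap in od' *; lia.
  have pw2 := odd_gap_pos _ _ _ _ pmin od2.
  have wj : j.+1 < w.
    by rewrite ltnNge; apply/negP => /(leq_pos l) jw; move: od2; rewrite /gap; lia.
  case: ifP => [_|adj]; first by rewrite /gap in pw2; lia.
  have := pos_gap_gt l p j.+1 w l0 pmin wj.
  by move: adj; case: (nth 0 l j.+1 == p); rewrite ?orbT //= => _ /(_ isT);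
    rewrite /gap in od2 *; lia.
case oa: (odd (a + L./2.+1)); last
  by apply: (key b a) => //; [rewrite addnC | rewrite oa].
by apply: (key a b) => //; lia.
Qed.

Lemma cost_le_exponent l p e : (forall q, q \in l -> 0 < q) ->
    min_odd_part l p -> all_walks l e ->
  forall j, j < size l -> cost l p j <= e.
Proof.
move=> l0 [pl op pmin] we j jl.
have midpoint := odd_closed_walk_midpoint l p j _ l0 op pmin jl _.
set m := _ + _ in midpoint.
have lr := posS l j; have := pos_le_sumn l j.+1 => rN.
have lj : 0 < nth 0 l j by rewrite l0 ?mem_nth.
have mN : m < sumn l by rewrite /m; lia.
have [oe|oe] := boolP (odd e).
  by apply: ltnW; apply: midpoint => //; apply: we => /=; apply: ltnW.
(* For even [e], a walk of length [e] from [m] to [m.+1] is closed by one step down. *)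
rewrite -ltnS; apply: midpoint => //; apply: walkS (step_down _ _ mN).
by apply: we => //=; apply: ltnW.
Qed.

Lemma odd_part_of_all_walks l e : (forall q, q \in l -> 0 < q) -> 0 < sumn l ->
  all_walks l e -> exists p, min_odd_part l p.
Proof.
move=> l0 N0 we; have [/hasP [q ql oq]|noodd] := boolP (has odd l).
  have ex : exists q, (q \in l) && odd q by exists q; rewrite ql.
  case: (ex_minnP ex) => p /andP[pl op] pmin.
  by exists p; split=> // r rl or; apply: pmin; rewrite rl.
(* With no odd part the lower bound [e.+1] holds vacuously. It excludes odd loops within length [e],
   and the walks from the hub to itself and to the rim end then force opposite parities on [e]. *)
have pmin q : q \in l -> odd q -> e.+1 <= q.
  by move=> ql oq; case/negP: noodd; apply/hasP; exists q.
have := hub_walk_bound _ _ _ _ pmin (we None None isT isT).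
have [w] := hub_walk_bound _ _ _ _ pmin (we None (Some (pos l 0)) isT (pos_le_sumn _ _)).
have := odd_gap_pos _ _ 0 w pmin.
case E: (odd (gap _ _)) => H1 H2 H3; last by lia.
by have := H1 isT; lia.
Qed.

(** * Exponents of compositions *)

Definition composition (N K : nat) (l : seq nat) : Prop :=
  [/\ forall a, a \in l -> 0 < a <= K, K \in l & sumn l = N].

(* [v] is the exponent of some matrix with [n = N + 2] and [k = K - 1]. *)
Definition has_cost (N K v : nat) : Prop :=
  exists l p, [/\ composition N K l, min_odd_part l p,
    forall j, j < size l -> cost l p j <= v &
    exists2 j, j < size l & cost l p j = v].

(** * Compositions attaining prescribed values *)

Lemma cost_even l p j : odd p -> ~~ odd (cost l p j).
Proof. by rewrite /cost => op; case: ifP => oL; [|case: ifP => _]; lia. Qed.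

Lemma cost_le l p j : odd p ->
  cost l p j <= if odd (nth 0 l j) then (nth 0 l j).+1 else nth 0 l j + p + 3.
Proof. by rewrite /cost => op; case: ifP => oL //; case: ifP => _; lia. Qed.

Lemma cost_ge l p j : odd p -> nth 0 l j < cost l p j.
Proof. by rewrite /cost => op; case: ifP => oL //; case: ifP => _; lia. Qed.

(** The parts of [t] are bounded by the cost they would have without a neighbour [p], so only the
    neighbour of [A] has to be examined. *)
Lemma has_cost_head N K p A t : composition N K (A :: t) ->
    min_odd_part (A :: t) p ->
    (forall L, L \in t ->
       (if odd L then L.+1 else L + p + 3) <= cost (A :: t) p 0) ->
  has_cost N K (cost (A :: t) p 0).
Proof.
move=> cN mp ht; exists (A :: t), p; split=> //; last by exists 0.
case=> // j jt; case: mp => _ op _.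
exact: leq_trans (cost_le (A :: t) p j.+1 op) (ht _ (@mem_nth _ 0 t j jt)).
Qed.

(** Take [K, 1, ..., 1], or the single part [K] if [N = K]; the value is the least even number above
    [K]. *)
Lemma has_cost_ones N K : 0 < K -> odd K && (K == N) || (K < N) ->
  has_cost N K (if odd K then K.+1 else K.+2).
Proof.
move=> K0 KN.
have [KN'|NK] := ltnP K N; last first.
  have [<- oK] : N = K /\ odd N by lia.
  have -> : (if odd N then N.+1 else N.+2) = cost [:: N] N 0 by rewrite /cost /= oK.
  apply: has_cost_head => //.
    by split=> [a||] /=; rewrite ?inE ?addn0 //; lia.
  by split=> [||q]; rewrite ?inE //; lia.
have [c cE] : exists c, N = K + c.+1 by exists (N - K).-1; lia.
have vE : (if odd K then K.+1 else K.+2) = cost (K :: nseq c.+1 1) 1 0.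
  by rewrite /cost /=; case: ifP; lia.
rewrite vE; apply: has_cost_head.
- split=> [a||]; rewrite ?inE ?eqxx //; last by rewrite /= sumn_nseq; lia.
  by rewrite mem_nseq; lia.
- by split=> [||q] //; [rewrite !inE orbT | lia].
- by move=> L; rewrite mem_nseq -vE => /andP[_ /eqP->] /=; case: ifP; lia.
Qed.

(** Take [A, 2, ..., 2, B, ..., B]: the twos keep [A] away from the least odd part [B]. *)
Lemma has_cost_separated N K A B c d : ~~ odd A -> odd B -> 0 < A <= K -> B <= K ->
    (K == A) || (K == B) -> 0 < c -> 0 < d -> N = A + c * 2 + d * B ->
  has_cost N K (A + B + 3).
Proof.
move=> eA oB AK BK KAB c0 d0 NE.
have K2 : 2 <= K by lia.
have cE : A + B + 3 = cost (A :: nseq c 2 ++ nseq d B) B 0.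
  rewrite /cost /=; case: ifP => [|_]; first lia.
  case: ifP => //; case: c c0 {NE} => //= c _; lia.
have mem a : a \in A :: nseq c 2 ++ nseq d B = [|| a == A, a == 2 | a == B].
  by rewrite inE mem_cat !mem_nseq c0 d0.
rewrite cE; apply: has_cost_head.
- split=> [a||]; rewrite ?mem; [lia|lia|].
  by rewrite /= sumn_cat !sumn_nseq; lia.
- by split=> [||q]; rewrite ?mem; lia.
- move=> L Lt; have : L \in A :: nseq c 2 ++ nseq d B by rewrite inE Lt orbT.
  by rewrite mem -cE; case: ifP; lia.
Qed.

(** Take [K, p, 2, ..., 2]. A two may cost [p + 5], which [4 <= K] keeps below the cost of [K]. *)
Lemma has_cost_adjacent N K p c : ~~ odd K -> 0 < K -> odd p -> p < K ->
    (c == 0) || (4 <= K) -> N = K + p + c * 2 ->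
  has_cost N K (K + p + 1).
Proof.
move=> eK K0 op pK cK NE.
have cE : K + p + 1 = cost (K :: p :: nseq c 2) p 0.
  rewrite /cost /=; case: ifP => [|_]; first lia.
  by rewrite eqxx orbT.
rewrite cE; apply: has_cost_head.
- split=> [a||]; rewrite ?inE ?eqxx //; first by rewrite mem_nseq; lia.
  by rewrite /= sumn_nseq; lia.
- by split=> [||q]; rewrite ?inE ?mem_nseq; lia.
- by move=> L; rewrite inE mem_nseq -cE; case: ifP; lia.
Qed.

(** Take [K.-1, K, p, x, ..., x]: the odd part [K] separates [K.-1] from [p]. Filling with ones,
    which suits both parities of [N], requires [p = 1]. *)
Lemma has_cost_shielded N K p x c : odd K -> odd p -> p.+2 <= K ->
    (x == 2) || (x == 1) && (p == 1) -> N = K.-1 + K + p + c * x ->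
  has_cost N K (K + p + 2).
Proof.
move=> oK op pK xp NE.
have cE : K + p + 2 = cost (K.-1 :: K :: p :: nseq c x) p 0.
  rewrite /cost /=; case: ifP => [|_]; first lia.
  by case: ifP; lia.
rewrite cE; apply: has_cost_head.
- split=> [a||]; rewrite ?inE ?eqxx ?orbT //; first by rewrite mem_nseq; lia.
  by rewrite /= sumn_nseq; lia.
- by split=> [||q]; rewrite ?inE ?mem_nseq; lia.
- by move=> L; rewrite !inE mem_nseq -cE; case: ifP; lia.
Qed.

(** With one or two twos, each can stand next to the only odd part [K]. *)
Lemma has_cost_twos K (b : bool) : odd K -> 2 < K ->
  has_cost (K + 2 + b * 2) K (K + 3).
Proof.
move=> oK K2; exists (2 :: K :: nseq b 2), K; split.
- split=> [a||]; rewrite ?inE ?eqxx ?orbT //; first by rewrite mem_nseq; case: (b); lia.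
  by rewrite /= sumn_nseq; lia.
- split=> [||q]; rewrite ?inE ?eqxx ?orbT ?mem_nseq //.
  by case: (b); lia.
- by case: b => -[|[|[|j]]] //= _; rewrite /cost /= ?oK ?eqxx ?orbT /=; lia.
- by exists 0; rewrite // /cost /= eqxx orbT; lia.
Qed.

(** * Restrictions on the attainable values *)

Lemma sumn_mem s r : r \in s -> exists s', [/\ sumn s = r + sumn s',
  forall q, q \in s -> q != r -> q \in s' & forall q, q \in s' -> q \in s].
Proof.
move=> rs; exists (rem r s); split=> [|q qs qr|q]; last exact: mem_rem.
  by rewrite (perm_sumn (perm_to_rem rs)).
by move: qs; rewrite (perm_mem (perm_to_rem rs)) inE (negPf qr).
Qed.

Lemma odd_sumn_mem s : odd (sumn s) -> exists2 q, q \in s & odd q.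
Proof.
elim: s => //= a s IH; case E: (odd a); first by exists a; rewrite ?inE ?eqxx.
rewrite oddD E /= => /IH[q qs oq]; by exists q; rewrite // inE qs orbT.
Qed.

(** Forgets the order of the parts: [L] attains the maximum, [s] is what is left besides [L] and one
    [p]. The larger value needs a part other than [p] to separate [L] from [p]. *)
Lemma has_cost_shape N K v : has_cost N K v -> [/\ ~~ odd v, K < v &
  (v <= K.+1) \/ exists L p s, [/\ [/\ ~~ odd L, 0 < L <= K & odd p && (p <= K)],
    N = L + p + sumn s,
    forall x, x \in s -> 0 < x <= K /\ (odd x -> p <= x),
    [\/ K = L, K = p | K \in s] &
    v = L + p + 1 \/ v = L + p + 3 /\ exists2 r, r \in s & r != p]].
Proof.
move=> [l [p [[lK Kl sl] [pl op pmin] hv [j jl jv]]]].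
split; first by rewrite -jv cost_even.
  have [i il <-] := nthP 0 Kl.
  exact: leq_trans (cost_ge _ _ _ op) (hv i il).
have Ll := mem_nth 0 jl; have := lK _ Ll; set L := nth 0 l j in Ll * => LK.
have [oL|eL] := boolP (odd L); first by left; rewrite -jv /cost -/L oL; lia.
right; have lE := cat_take_drop j l; rewrite (drop_nth 0 jl) -/L in lE.
set s := take j l ++ drop j.+1 l.
have ls : perm_eq l (L :: s) by rewrite -{1}lE perm_catC /= perm_cons perm_catC.
have ps : p \in s.
  by move: pl; rewrite (perm_mem ls) inE => /orP[/eqP pL|//]; lia.
have pp := perm_to_rem ps.
have lE2 : perm_eq l (L :: p :: rem p s).
  by rewrite (perm_trans ls) // perm_cons.
exists L, p, (rem p s); split.
- by split=> //; case/andP: (lK _ pl) => _ ->; rewrite op.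
- by rewrite -sl (perm_sumn lE2) /= addnA.
- move=> x xs; have xl : x \in l by rewrite (perm_mem lE2) !inE xs !orbT.
  by split; [exact: lK | exact: pmin].
- by move: Kl; rewrite (perm_mem lE2) !inE => /or3P[/eqP|/eqP|];
    [constructor 1|constructor 2|constructor 3].
move: jv; rewrite /cost -/L (negPf eL); case: ifP => [_|adj]; first by left.
move=> <-; right; split=> //.
(* Were all parts besides [L] equal to [p], some neighbour of [L] would be [p]. *)
have [|/hasPn noadj] := boolP (has (predC1 p) (rem p s)).
  by case/hasP=> r; exists r.
have allp x : x \in s -> x = p.
  by rewrite (perm_mem pp) inE => /orP[/eqP//|/noadj /= /negPn /eqP].
have allL x : x \in take j l -> x = p.
  by move=> xl; apply: allp; rewrite mem_cat xl.
exfalso; move: ps adj; rewrite /s mem_cat => /orP[].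
  case: (j) jl allL => [|i] il allL; first by rewrite take0.
  move=> _ /=; rewrite (allL (nth 0 l i)) ?eqxx //.
  rewrite -(nth_take 0 (ltnSn i)); apply: mem_nth.
  by rewrite size_takel // ltnW.
case E: (drop j.+1 l) => [|b t] // _.
have -> : nth 0 l j.+1 = b by rewrite -[j.+1]addn0 -nth_drop E.
by rewrite (allp b) ?eqxx ?orbT // /s E mem_cat inE eqxx orbT.
Qed.

(** [L] and [p] differ in parity, so they are not both [K]. *)
Lemma has_cost_le N K v : has_cost N K v -> v <= K.*2.+2.
Proof.
case/has_cost_shape=> ev Kv [|[L [p [s [[eL LK /andP[op pK]] NE sK Ks vE]]]]]; first lia.
by case: vE => [->|[-> _]]; lia.
Qed.

(** * The sets of values, by the parities and the range of [N] and [K] *)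

Lemma has_cost_large N K v : 2 <= K ->
    (odd N /\ 2 * K < N) \/ (~~ odd N /\ 3 * K <= N) ->
  has_cost N K v <-> (K.+1 <= v <= K.*2.+2) /\ ~~ odd v.
Proof.
move=> K2 NK; split=> [H|[vK ev]].
  by have := has_cost_le _ _ _ H; have [] := has_cost_shape _ _ _ H; lia.
have [oK|eK] := boolP (odd K); last first.
  have [->|vK'] : v = K.+2 \/ K.+4 <= v by lia.
    by have := has_cost_ones N K; rewrite (negPf eK); apply; lia.
  have -> : v = K + (v - K - 3) + 3 by lia.
  (* The number of copies of the odd part must have the parity of [N]: one copy or two, the rest
     being filled with twos. *)
  by case: (boolP (odd N)) => oN;
    [apply: (@has_cost_separated N K _ _ ((N - v + 3)./2) 1)
    |apply: (@has_cost_separated N K _ _ ((N - (2 * v - K - 6))./2) 2)]; lia.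
have [->|[->|vK']] : v = K.+1 \/ (v = K + 1 + 2 \/ K.+4 < v) by lia.
- by have := has_cost_ones N K; rewrite oK; apply; lia.
- by apply: (@has_cost_shielded _ _ _ 1 (N - K.*2)); lia.
have -> : v = (v - K - 3) + K + 3 by lia.
by case: (boolP (odd N)) => oN;
  [apply: (@has_cost_separated N K _ _ ((N - v + 3)./2) 1)
  |apply: (@has_cost_separated N K _ _ ((N - v - K + 3)./2) 2)]; lia.
Qed.

(** [L + p] is odd like [N], so a nonempty rest has sum at least 2, which makes up for the larger
    cost. *)
Lemma has_cost_odd_le N K v : odd N -> K <= N -> has_cost N K v -> v <= N.+1.
Proof.
move=> oN KN /has_cost_shape[ev Kv [|[L [p [s [[eL LK /andP[op pK]] NE sK Ks vE]]]]]].
  by lia.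
case: vE => [->|[-> [r rs rp]]]; first by lia.
have [s' [sE _ _]] := sumn_mem _ _ rs; have := sK _ rs; lia.
Qed.

Lemma has_cost_odd_even N K v : 0 < K -> ~~ odd K -> odd N -> K <= N < K.*2 ->
  has_cost N K v <-> (K.+1 <= v <= N.+1) /\ ~~ odd v.
Proof.
move=> K0 eK oN KN; split=> [H|[vK ev]].
  have := has_cost_odd_le _ _ _ oN _ H; have [] := has_cost_shape _ _ _ H; lia.
have -> : v = K + (v - K - 1) + 1 by lia.
by apply: (@has_cost_adjacent _ _ _ ((N - (v - 1))./2)); lia.
Qed.

Lemma not_has_cost_add3 N K : odd K -> odd N -> K + 6 <= N < K.*2 ->
  ~ has_cost N K (K + 3).
Proof.
move=> oK oN KN [l [p [[lK Kl sl] [pl op pmin] hv [j jl jv]]]].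
have := pmin _ Kl oK; rewrite leq_eqVlt => /orP[/eqP pK|pK]; last first.
  (* If [p < K], the value comes from an even [L] with [L + p >= K]; the parts [K], [L], [p] are
     then too long for [N < K.*2]. *)
  have Ll := mem_nth 0 jl; move: jv; rewrite /cost; set L := nth 0 l j in Ll *.
  have LK := lK _ Ll; case: ifP => oL jv; first by lia.
  have [s1 [s1E r1 m1]] := sumn_mem _ _ Kl.
  have [|s2 [s2E r2 m2]] := sumn_mem s1 L; first by apply: r1 => //; lia.
  have [|s3 [s3E r3 m3]] := sumn_mem s2 p; first by apply: r2; [apply: r1 => //|]; lia.
  have [|q qs oq] := odd_sumn_mem s3; first by lia.
  have [s4 [s4E _ _]] := sumn_mem _ _ qs.
  have := pmin q (m1 _ (m2 _ (m3 _ qs))) oq.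
  by move: jv; case: ifP => _; lia.
(* Now [p = K]: the other parts are smaller, hence even, and the bound [K + 3] on their costs leaves
   only twos. *)
have [m ml mK] := nthP 0 Kl.
have ltK i : i != m -> nth 0 l i < K.
  by move=> /(nth_add_le_sumn l); rewrite mK; lia.
have evenK i : i != m -> odd (nth 0 l i) = false.
  move=> im; have iK := ltK _ im.
  have [il|li] := ltnP i (size l); last by rewrite nth_default.
  apply/negP => oi; have : p <= nth 0 l i by rewrite pmin ?mem_nth.
  by lia.
have le2 i : i != m -> nth 0 l i <= 2.
  move=> im; have [il|li] := ltnP i (size l); last by rewrite nth_default.
  by have := hv i il; rewrite /cost (evenK _ im); case: ifP => _; lia.
(* As [K + 6 <= N] there are at least three twos, so one is not next to [K] and costs [K + 5]. *)
have [i [il im]] : exists i, i < size l /\ (i.+2 <= m \/ m.+2 <= i).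
  have [m2|m2] := leqP 2 m; first by exists 0; split; [lia | left].
  have [lm|ml2] := leqP (size l) m.+2; last by exists m.+2; split=> //; right.
  have := leq_pos l _ _ lm; rewrite pos_size !posS mK.
  have := le2 m.+1 (negbT (gtn_eqF (ltnSn m))).
  by case: m m2 {ml mK ltK evenK lm} le2 => [|[|m]] // _ le2; rewrite ?posS pos0;
    try have := le2 0 isT; lia.
have := hv i il; rewrite /cost (evenK i); last by lia.
have i0 : 0 < nth 0 l i by have /andP[] := lK _ (mem_nth 0 il).
case: ifP => [|_]; last by lia.
have := ltK i.+1; case: i il im i0 => [|i] il im i0 /=; first by lia.
by have := ltK i; lia.
Qed.

Lemma has_cost_odd_odd N K v : odd K -> 2 < K -> odd N ->
  (N == K) || (K + 6 <= N < K.*2) ->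
  has_cost N K v <-> [/\ K.+1 <= v <= N.+1, ~~ odd v & v != K + 3].
Proof.
move=> oK K2 oN NK; split=> [H|[vK ev v3]].
  have [ev Kv _] := has_cost_shape _ _ _ H.
  have vN : v <= N.+1 by apply: has_cost_odd_le H => //; lia.
  split=> //; first by lia.
  case/orP: NK => NK; first by lia.
  by apply/eqP => vE; apply: (not_has_cost_add3 _ _ oK oN NK); rewrite -vE.
have [->|vK'] : v = K.+1 \/ K.+4 < v by lia.
  by have := has_cost_ones N K; rewrite oK; apply; lia.
have -> : v = (v - K - 3) + K + 3 by lia.
by apply: (@has_cost_separated N K _ _ ((N - (v - 3))./2) 1); lia.
Qed.

Lemma has_cost_odd_small N K v : odd K -> 2 < K -> (N == K + 2) || (N == K + 4) ->
  has_cost N K v <-> (K.+1 <= v <= N.+1) /\ ~~ odd v.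
Proof.
move=> oK K2 NK; split=> [H|[vK ev]].
  by have := has_cost_odd_le N K _ _ _ H; have [] := has_cost_shape _ _ _ H; lia.
have [->|[->|[-> NE]]] : v = K.+1 \/ (v = K + 3 \/ v = 2 + K + 3 /\ N = K + 4) by lia.
- by have := has_cost_ones N K; rewrite oK; apply; lia.
- case/orP: NK => /eqP->.
    by have := has_cost_twos K false oK K2; rewrite addn0.
  by have := has_cost_twos K true oK K2; rewrite -addnA.
by apply: (@has_cost_separated N K _ _ 1 1); lia.
Qed.

(** Since [N] is even, odd parts come in pairs: besides [K] there are two of length at least [p], so
    [2 * p <= N - K]. Hence the quotient by 4. *)
Lemma has_cost_even_even N K v : 0 < K -> ~~ odd K -> ~~ odd N -> K < N <= 3 * K - 2 ->
  has_cost N K v <-> (K.+2 <= v <= K.+2 + 2 * ((N - K) %/ 4)) /\ ~~ odd v.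
Proof.
move=> K0 eK eN KN; split=> [|[vK ev]]; last first.
  have [->|vK'] : v = K.+2 \/ K.+4 <= v by lia.
    by have := has_cost_ones N K; rewrite (negPf eK); apply; lia.
  have -> : v = K + (v - K - 3) + 3 by lia.
  by apply: (@has_cost_separated N K _ _ ((N - K - 2 * (v - K - 3))./2) 2); lia.
case/has_cost_shape=> ev Kv [|[L [p [s [[eL LK /andP[op pK]] NE sK Ks vE]]]]].
  by lia.
split=> //.
have os : odd (sumn s) by lia.
case: (eqVneq K L) Ks => [KL _|KL Ks].
  have [q qs oq] := odd_sumn_mem _ os; have [s' [sE srem _]] := sumn_mem _ _ qs.
  have [qK /(_ oq) pq] := sK _ qs.
  case: vE => [vE|[vE [r rs rp]]]; first by lia.
  have rq : r == q \/ r \in s' by case: eqVneq => ?; [left|right; apply: srem].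
  case: rq => [/eqP rq|rs']; first by lia.
  have [s2 [s2E _ _]] := sumn_mem _ _ rs'; have [rK _] := sK _ rs; lia.
have {}Ks : K \in s by case: Ks => // ?; lia.
have [s' [sE _ ss]] := sumn_mem _ _ Ks.
have [|q qs' oq] := odd_sumn_mem s'; first by lia.
have [s2 [s2E _ _]] := sumn_mem _ _ qs'.
have [_ /(_ oq) pq] := sK _ (ss _ qs'); lia.
Qed.

(** The rest [s] has odd sum, and it contains [K] or, if [p = K], a second odd part of at least that
    length; so [L + p <= N - K]. *)
Lemma has_cost_even_odd_le N K v : odd K -> ~~ odd N -> has_cost N K v ->
  v <= maxn K.+1 (N - K + 3).
Proof.
move=> oK eN /has_cost_shape[ev Kv [|[L [p [s [[eL LK /andP[op pK]] NE sK Ks vE]]]]]].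
  by lia.
have : K <= sumn s.
  case: Ks => [|pE|Ks]; first by lia.
    have [|q qs' oq] := odd_sumn_mem s; first by lia.
    have [s2 [s2E _ _]] := sumn_mem _ _ qs'.
    have [_ /(_ oq) pq] := sK _ qs'; lia.
  by have [s2 [s2E _ _]] := sumn_mem _ _ Ks; lia.
by case: vE => [->|[-> _]]; lia.
Qed.

Lemma has_cost_even_odd N K v : odd K -> ~~ odd N -> K < N <= 3 * K - 3 ->
  has_cost N K v <-> (K.+1 <= v <= maxn K.+1 (N - K + 3)) /\ ~~ odd v.
Proof.
move=> oK eN KN; split=> [H|[vK ev]].
  by have := has_cost_even_odd_le _ _ _ oK eN H; have [] := has_cost_shape _ _ _ H; lia.
have [->|vK'] : v = K.+1 \/ K + 3 <= v by lia.
  by have := has_cost_ones N K; rewrite oK; apply; lia.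
have -> : v = K + (v - K - 2) + 2 by lia.
by apply: (@has_cost_shielded _ _ _ 2 ((N - (K.-1 + v - 2))./2)); lia.
Qed.

(** The value [2 * K + 2] would need [L = K - 1], [p = K] and a second odd part [K]; these fill [N],
    leaving nothing to separate [L] from [p]. *)
Lemma has_cost_even_odd_last K v : odd K -> 2 < K ->
  has_cost (3 * K - 1) K v <-> (K.+1 <= v <= K.*2) /\ ~~ odd v.
Proof.
move=> oK K2; split=> [|[vK ev]]; last first.
  have [->|vK'] : v = K.+1 \/ K + 3 <= v by lia.
    by have := has_cost_ones (3 * K - 1) K; rewrite oK; apply; lia.
  have -> : v = K + (v - K - 2) + 2 by lia.
  by apply: (@has_cost_shielded _ _ _ 2 ((3 * K - 1 - (K.-1 + v - 2))./2)); lia.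
case/has_cost_shape=> ev Kv [|[L [p [s [[eL LK /andP[op pK]] NE sK Ks vE]]]]].
  by lia.
split=> //.
have [pE|pE] := eqVneq p K; last by case: vE => [vE|[vE _]]; lia.
have [|q qs oq] := odd_sumn_mem s; first by lia.
have [s' [sE srem _]] := sumn_mem _ _ qs.
have [qK /(_ oq) pq] := sK _ qs.
case: vE => [vE|[vE [r rs rp]]]; first by lia.
have [s2 [s2E _ _]] : exists s2, [/\ sumn s' = r + sumn s2, true & true].
  by have [|s2 [? _ _]] := sumn_mem s' r; [apply: srem => //; lia | exists s2].
have [rK _] := sK _ rs; lia.
Qed.

(** * Matrices *)

Definition vtx {n : nat} (i : 'I_n) : option nat :=
  if i < n.-1 then Some (i : nat) else None.

(** Only signs are recorded, because the entry joining the last rim vertex to the hub may be 2. *)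
Definition adjacency {R : realType} {n : nat} (l : seq nat) (B : 'M[R]_n) : Prop :=
  forall i j : 'I_n, (0 <= B i j)%R /\ ((0 < B i j)%R <-> step l (vtx i) (vtx j)).

Lemma vertex_vtx n l (i : 'I_n) : (sumn l).+2 = n -> vertex l (vtx i).
Proof. by move=> ln; rewrite /vtx /vertex; case: ifP => //; lia. Qed.

Lemma vtx_surj n l u : (sumn l).+2 = n -> vertex l u ->
  exists i : 'I_n, vtx i = u.
Proof.
move=> ln; case: u => [r|] /= rl.
  by have rn : r < n by [lia]; exists (Ordinal rn); rewrite /vtx /= ifT //; lia.
have rn : n.-1 < n by lia.
by exists (Ordinal rn); rewrite /vtx /= ltnn.
Qed.

Lemma vtx_inj n : injective (@vtx n).
Proof.
move=> i j; rewrite /vtx; case: ifP => iN; case: ifP => jN //; first by case=> /val_inj.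
by move=> _; apply: val_inj => /=; have := ltn_ord i; have := ltn_ord j; lia.
Qed.

(** Nonnegativity is carried along, since it makes a sum of products positive exactly when one term
    is. *)
Lemma expmx_walk (R : realType) n l (B : 'M[R]_n) e (i j : 'I_n) :
    (sumn l).+2 = n -> adjacency l B ->
  (0 <= (B ^+ e)%R i j)%R /\ ((0 < (B ^+ e)%R i j)%R <-> walk l (vtx i) e (vtx j)).
Proof.
move=> ln Bl; elim: e j => [|e IH] j.
  rewrite expr0 mxE; split; first by case: eqP; rewrite ?ler01.
  split; first by case: eqP => [-> _|]; [apply: walk0 | rewrite ltxx].
  move=> w; suff -> : i = j by rewrite eqxx ltr01.
  by apply: vtx_inj; inversion w.
rewrite exprSr.
have -> : ((B ^+ e * B)%R i j = \sum_m (B ^+ e)%R i m * B m j)%R by rewrite mxE.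
have ge0 m : true -> (0 <= (B ^+ e)%R i m * B m j)%R.
  by move=> _; rewrite mulr_ge0 ?(IH _).1 ?(Bl _ _).1.
split; first exact: sumr_ge0.
split.
  rewrite lt0r psumr_neq0 // => /andP[/hasP[m _ /= mP] _].
  have [im mj] : (0 < (B ^+ e)%R i m)%R /\ (0 < B m j)%R.
    move: mP; rewrite !lt0r (IH _).1 (Bl _ _).1 mulf_eq0 negb_or !andbT.
    by case/andP=> /andP[].
  by apply: walkS ((Bl _ _).2.1 mj); apply/(IH m).2.
case/walkSE=> v wv vj.
have [m mE] := vtx_surj _ _ _ ln (step_vertex _ _ _ (step_sym _ _ _ vj)).
rewrite -mE in wv vj.
rewrite lt0r sumr_ge0 // andbT psumr_neq0 //; apply/hasP; exists m.
  by rewrite mem_index_enum.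
by rewrite /= mulr_gt0 //; [apply/(IH m).2 | apply/(Bl _ _).2].
Qed.

Lemma positive_mx_walks (R : realType) n l (B : 'M[R]_n) e :
  (sumn l).+2 = n -> adjacency l B -> positive_mx (B ^+ e)%R <-> all_walks l e.
Proof.
move=> ln Bl; have expB i j := expmx_walk _ _ _ _ e i j ln Bl.
split=> [Be u v ul vl|we i j]; last first.
  by apply/(expB i j).2; apply: we; apply: vertex_vtx.
have [[i <-] [j <-]] := (vtx_surj _ _ _ ln ul, vtx_surj _ _ _ ln vl).
exact: (expB i j).2.1 (Be i j).
Qed.

Lemma Fmx_adjacency (R : realType) n l (A : 'M[R]_n) : (sumn l).+2 = n ->
    Cmx R n A ->
    (forall i j : 'I_n, i = n.-1 :> nat -> j = n.-1 :> nat -> A i j = 0%R) ->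
    (forall i j : 'I_n, i = n.-1 :> nat -> j < n.-1 ->
       (0 < Fmx A i j)%R <-> exists m, pos l m = j) ->
  adjacency l (Fmx A).
Proof.
move=> ln CA Ann Al i j.
have A01 a b : (A a b = 0 \/ A a b = 1)%R.
  have := CA a b; case: ifP => // _ ->; by case: eqP; [right|left].
have A0 a b : (0 <= A a b)%R by case: (A01 a b) => ->; rewrite ?ler01.
have FC a b : Fmx A a b = Fmx A b a by rewrite !mxE addrC.
split; first by rewrite !mxE addr_ge0.
rewrite /vtx; case: ifP => iN; case: ifP => jN.
- have := CA i j; have := CA j i; rewrite iN jN !mxE => -> ->.
  rewrite step_rim; split.
    case: eqP => [|_]; first by left; lia.
    by case: eqP => [|_]; [right; lia | rewrite addr0 ltxx].
  by case=> -[h ->]; rewrite eqxx ?(addrC _ 1%R) ltr_wpDr ?ltr01 ?ler0n.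
- by rewrite step_hub FC; apply: Al => //; have := ltn_ord j; lia.
- rewrite Al //; last by have := ltn_ord i; lia.
  by rewrite -step_hub; split; apply: step_sym.
- rewrite !mxE !Ann ?addr0 ?ltxx; try by have := ltn_ord i; have := ltn_ord j; lia.
  by split=> // /step_hubhub.
Qed.

Lemma Cmx10_adjacency (R : realType) n (B : 'M[R]_n) : 2 <= n -> Cmx10 R n B ->
  exists l : seq nat, [/\ forall a, a \in l -> 0 < a, (sumn l).+2 = n & adjacency l B].
Proof.
move=> n2 [A [CA A1 A0] <-].
have hn : n.-1 < n by lia.
pose hub := Ordinal hn.
pose P r := if insub r is Some j then (0 < Fmx A hub j)%R else false.
have PE (j : 'I_n) : P j = (0 < Fmx A hub j)%R by rewrite /P valK.
have A01 a b : (A a b = 0 \/ A a b = 1)%R.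
  have := CA a b; case: ifP => // _ ->; by case: eqP; [right|left].
have Age0 a b : (0 <= A a b)%R by case: (A01 a b) => ->; rewrite ?ler01.
have [||l [l0 ls lP]] := marks_parts n.-2 P.
- have h0 : 0 < n by lia.
  by rewrite (PE (Ordinal h0)) !mxE (A1 hub) // ltr_wpDr ?ltr01.
(* The last spoke comes from the entry 1 that the last but one row of [A] has in the hub column. *)
- have h2 : n.-2 < n by lia.
  rewrite (PE (Ordinal h2)) !mxE ltr_wpDl //.
  have hE : (hub == (Ordinal h2).+1 :> nat) = true by apply/eqP => /=; lia.
  have := CA (Ordinal h2) hub; rewrite hE ifT => [->|]; first exact: ltr01.
  by rewrite /=; lia.
exists l; split=> //; first by lia.
apply: Fmx_adjacency => //; first by lia.
move=> i j iN jN; rewrite -lP; last by lia.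
by rewrite PE; have -> : i = hub by apply: val_inj.
Qed.

Lemma adjacency_Cmx10 (R : realType) n l : (sumn l).+2 = n ->
  exists2 B : 'M[R]_n, Cmx10 R n B & adjacency l B.
Proof.
move=> ln.
pose mark r := [exists m : 'I_(size l).+1, pos l m == r].
pose A : 'M[R]_n := (\matrix_(i, j)
  if (i < n.-1)%N then (j == i.+1 :> nat)%:R else (mark j)%:R)%R.
have markP r : mark r <-> exists j, pos l j = r.
  split=> [/existsP[m /eqP]|[j jr]]; first by exists m.
  apply/existsP; case: (leqP j (size l)) => jl.
    by exists (Ordinal (jl : j < (size l).+1)); apply/eqP.
  exists ord_max; apply/eqP; rewrite -jr /= /pos take_size take_oversize //.
  exact: ltnW.
have CA : Cmx R n A.
  move=> i j; rewrite mxE; case: (i < n.-1) => //.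
  by case: (mark j); [right|left].
have A0 (i j : 'I_n) : i = n.-1 :> nat -> j = n.-1 :> nat -> A i j = 0%R.
  move=> iN jN; rewrite mxE iN ltnn; case: (boolP (mark j)) => // /markP[m].
  by have := pos_le_sumn l m; lia.
exists (Fmx A).
  exists A => //; split=> // i j iN jN; rewrite mxE iN ltnn.
  by have -> // : mark j; apply/markP; exists 0; rewrite pos0.
apply: Fmx_adjacency => // i j iN jN.
rewrite -markP !mxE iN ltnn jN.
case: (boolP (mark j)) => [_|noj]; split=> //.
  by move=> _; rewrite ltr_wpDr ?ltr01 ?ler0n.
(* The transpose contributes only at the last rim vertex, which is already marked by
   [pos l (size l)]. *)
rewrite add0r; case: eqP => [jE _|_]; last by rewrite ltxx.
case/negP: noj; apply/markP; exists (size l); rewrite pos_size.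
by lia.
Qed.

(** * Zero blocks of the last row and exponents *)

Lemma card_ord_interval n a b : a <= b < n ->
  #|[set i : 'I_n | a <= i <= b]%SET| = b.+1 - a.
Proof.
move=> /andP[ab bn]; rewrite -sum1_card.
rewrite (eq_bigl (fun i : 'I_n => a <= i <= b)); last by move=> i; rewrite inE.
rewrite -(big_mkord (fun i => a <= i <= b) (fun=> 1)).
rewrite -[RHS]muln1 -sum_nat_const_nat (big_nat_widenl a 0) //.
by rewrite (big_nat_widen 0 b.+1 n).
Qed.

Lemma mem_V1 (R : realType) n l (B : 'M[R]_n) (i : 'I_n) : (sumn l).+2 = n ->
  adjacency l B -> i \in V1 B <-> i < n.-1 /\ forall j, pos l j != i.
Proof.
move=> ln Bl; have hn : n.-1 < n by lia.
rewrite inE; split=> [/andP[iN /forallP/(_ (Ordinal hn))]|[iN im]].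
  rewrite eqxx /= => /eqP B0; split=> // j; apply/eqP => ji.
  have [_ BE] := Bl (Ordinal hn) i.
  have : step l (vtx (Ordinal hn)) (vtx i).
    by rewrite /vtx /= ltnn iN -ji; constructor.
  by move/BE; rewrite B0 ltxx.
rewrite iN; apply/forallP => r; apply/implyP => /eqP rN.
have [B0 BE] := Bl r i; move: B0; rewrite le_eqVlt eq_sym => /orP[//|/BE].
rewrite /vtx iN rN ltnn => /(step_sym _ _ _)/step_hub[j ji].
by have := im j; rewrite ji eqxx.
Qed.

(** A block lies strictly between two consecutive spokes, and the interior of a part [K] is a block
    if [1 < K]. *)
Lemma max_block_V1 (R : realType) n l K (B : 'M[R]_n) : (sumn l).+2 = n ->
  (forall a, a \in l -> 0 < a <= K) -> K \in l -> adjacency l B ->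
  max_block (V1 B) = K.-1.
Proof.
move=> ln lK Kl Bl.
have V1P i := mem_V1 _ _ _ _ i ln Bl.
have K0 : 0 < K by case/andP: (lK _ Kl).
apply/eqP; rewrite eqn_leq; apply/andP; split.
  apply/bigmax_leqP => W /maxsetP[/andP[/existsP[a /existsP[b /andP[ab /eqP WE]]] WV] _].
  have aW : a \in W by rewrite WE inE leqnn.
  have /V1P[aN am] := fintype.subsetP WV _ aW.
  have bW : b \in W by rewrite WE inE leqnn andbT.
  have /V1P[bN _] := fintype.subsetP WV _ bW.
  have [||j jl aj] := pos_segment l a; [by case: (l) Kl | lia |].
  have jK : 0 < nth 0 l j <= K := lK _ (mem_nth 0 jl).
  have := am j; have := am j.+1 => j1 j2.
  have : b < pos l j.+1.
    rewrite ltnNge; apply/negP => jb.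
    have jn : pos l j.+1 < n by have := pos_le_sumn l j.+1; lia.
    have : Ordinal jn \in W by rewrite WE inE /= jb; lia.
    by move=> /(fintype.subsetP WV)/V1P[_ /(_ j.+1)]; rewrite eqxx.
  rewrite WE card_ord_interval; last by rewrite ab ltn_ord.
  by move: aj j1 j2; rewrite posS; lia.
have [K1|K1] := leqP K 1; first by lia.
have [j jl jK] := nthP 0 Kl.
have jN := pos_le_sumn l j.+1; rewrite posS jK in jN.
have an : (pos l j).+1 < n by lia.
have bn : (pos l j + K).-1 < n by lia.
pose W0 := [set i : 'I_n | (pos l j).+1 <= i <= (pos l j + K).-1]%SET.
have blockW0 : block W0 && (W0 \subset V1 B).
  apply/andP; split.
    apply/existsP; exists (Ordinal an); apply/existsP; exists (Ordinal bn).
    by rewrite eqxx andbT /=; lia.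
  apply/fintype.subsetP => i; rewrite inE => iW; apply/V1P; split; first by lia.
  move=> m; apply/eqP => mi; case: (leqP m j) => /(leq_pos l); first by lia.
  by rewrite posS jK; lia.
have [W maxW W0W] := @maxset_exists _ (fun W => block W && (W \subset V1 B)) W0 blockW0.
apply: leq_trans (leq_bigmax_cond _ maxW).
by apply: leq_trans (subset_leq_card W0W); rewrite card_ord_interval; lia.
Qed.

Lemma max_part l : 0 < sumn l -> exists2 K, K \in l & forall a, a \in l -> a <= K.
Proof.
move=> l0; have ex : exists a, a \in l.
  by case: l l0 => // a l _; exists a; rewrite inE eqxx.
have ub a : a \in l -> a <= sumn l.
  by move=> /sumn_mem[s [-> _ _]]; rewrite leq_addr.
by case: (ex_maxnP ex ub) => K Kl Kmax; exists K.
Qed.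

Lemma exponents_PSC10k (R : realType) N K v : 0 < N -> 0 < K ->
  exponents (PSC10k R N.+2 K.-1) v <-> has_cost N K v.
Proof.
move=> N0 K0; split.
  case=> B [[[CB _] mB] _ [v0 Bv minv]].
  have [|l [l0 ln Bl]] := Cmx10_adjacency _ _ _ _ CB; first by [].
  have walks e : positive_mx (B ^+ e)%R <-> all_walks l e.
    exact: positive_mx_walks.
  have sl : sumn l = N by lia.
  have /walks lv := Bv.
  have [|p mp] := odd_part_of_all_walks _ _ l0 _ lv; first by rewrite sl.
  have [|M Ml lM] := max_part l; first by rewrite sl.
  (* The block size gives [M.-1 = K.-1]; positivity of both sides removes the predecessors. *)
  have MK : M = K.
    have lM' a : a \in l -> 0 < a <= M by move=> al; rewrite l0 // lM.
    have := max_block_V1 _ _ _ _ _ ln lM' Ml Bl; rewrite mB.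
    by have := l0 _ Ml; lia.
  have size0 : 0 < #|'I_(size l)| by rewrite card_ord; case: (l) Ml.
  have [j jE] := bigop.eq_bigmax (fun j : 'I_(size l) => cost l p j) size0.
  have jmax i : i < size l -> cost l p i <= cost l p j.
    move=> il; rewrite -jE.
    exact: (@bigop.leq_bigmax _ (fun j : 'I_(size l) => cost l p j) (Ordinal il)).
  have [pl op _] := mp.
  exists l, p; split=> //.
  - by split=> // [a al|]; rewrite -?MK // l0 // lM.
  - exact: cost_le_exponent.
  exists j => //; apply/eqP; rewrite eqn_leq (cost_le_exponent _ _ _ l0 mp lv) //=.
  apply: minv; first by apply: leq_ltn_trans (cost_ge _ _ _ op).
  by apply/walks; apply: all_walks_cost mp _ jmax _; rewrite ?cost_even.
case=> l [p [[lK Kl sl] mp hv [j jl jv]]].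
have l0 a : a \in l -> 0 < a by move=> /lK/andP[].
have ln : (sumn l).+2 = N.+2 by rewrite sl.
have [B CB Bl] := adjacency_Cmx10 R N.+2 l ln.
have walks e : positive_mx (B ^+ e)%R <-> all_walks l e by exact: positive_mx_walks.
have [_ op _] := mp.
have v0 : 0 < v by rewrite -jv; apply: leq_ltn_trans (cost_ge _ _ _ op).
have Bv : positive_mx (B ^+ v)%R.
  by apply/walks; apply: all_walks_cost mp _ hv _; rewrite // -jv cost_even.
have prim : primitive_mx B by exists v.
exists B; split=> //; last split=> // e _ /walks le.
  by split=> //; apply: max_block_V1 lK Kl Bl.
by rewrite -jv; apply: cost_le_exponent le _ jl.
Qed.

Local Open Scope classical_set_scope.

Theorem theorem6 (R : realType) (n k : nat) (hn : 5 <= n) (hk : 1 <= k) :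
  [/\
    (* (1) *)
    (odd n /\ 2 * (k + 2) + 1 <= n) \/ (~~ odd n /\ 3 * (k + 2) - 1 <= n) ->
      exponents (PSC10k R n k) = evens (k + 2) (2 * (k + 2)),
    (* (2) *)
    odd k -> odds (k + 3) (2 * (k + 2) - 1) n ->
      exponents (PSC10k R n k) = evens (k + 2) (n - 1),
    (* (3) *)
    ~~ odd k ->
      ((odds (k + 3) (2 * (k + 2) - 1) `\` [set k + 5; k + 7]) n ->
         exponents (PSC10k R n k) = evens (k + 2) (n - 1) `\` [set k + 4])
      /\ ([set k + 5; k + 7] n ->
         exponents (PSC10k R n k) = evens (k + 2) (n - 1)),
    (* (4) *)
    odd k -> evens (k + 5) (3 * (k + 1)) n ->
      let q := (n - k - 4) %/ 4 in
      (n - k - 4 = 4 * q + 1 ->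
         exponents (PSC10k R n k) = evens (k + 3) (k + 2 * q + 3))
      /\ (n - k - 4 = 4 * q + 3 ->
         exponents (PSC10k R n k) = evens (k + 3) (k + 2 * q + 5))
    (* (5) *)
    & ~~ odd k ->
      (evens (k + 4) (3 * k + 2) n ->
         (~~ (n - k <= k + 2) ->
            exponents (PSC10k R n k) = evens (k + 2) (n - k))
         /\ (n - k <= k + 2 ->
            exponents (PSC10k R n k) = [set k + 2]))
      /\ (n = 3 * (k + 1) + 1 ->
         exponents (PSC10k R n k) = evens (k + 2) (2 * (k + 1)))].
Proof.
(* With [N = n - 2] and [K = k + 1], the parity of [n] is that of [N], while that of [k] is opposite
   to that of [K]. *)
have [N nE] : exists N, n = N.+2 by exists n.-2; lia.
have expE v : exponents (PSC10k R n k) v <-> has_cost N k.+1 v.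
  by rewrite nE; apply: (exponents_PSC10k R N k.+1 v); lia.
have toset X : (forall v, has_cost N k.+1 v <-> X v) -> exponents (PSC10k R n k) = X.
  by move=> XE; apply/seteqP; split=> v /=; [move/expE/XE | move/XE/expE].
have cond (a b c d v : nat) : a = c -> b = d ->
    (a <= v <= b) /\ ~~ odd v <-> evens c d v by move=> -> ->.
rewrite /odds; split.
- move=> nk; apply: toset => v; rewrite has_cost_large; [apply: cond| |]; lia.
- move=> ok [nk on]; apply: toset => v.
  by rewrite has_cost_odd_even; [apply: cond| | | |]; lia.
- move=> ek; split=> [[[nk on] nk2]|nk]; apply: toset => v; last first.
    by rewrite has_cost_odd_small; [apply: cond| | |]; case: nk => /= nk; lia.
  rewrite has_cost_odd_odd; [|lia|lia|lia|]; last first.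
    have n5 : n <> k + 5 by move=> h; apply: nk2; left.
    have n7 : n <> k + 7 by move=> h; apply: nk2; right.
    by lia.
  split=> [[vk ev v3]|[[vk ev] v3]].
    by split; [split=> //; lia | rewrite /=; lia].
  by split=> //; [lia | apply/eqP => h; apply: v3; rewrite /= h; lia].
(* [N - K] is [4 * q + 2] or [4 * q + 4], with quotient [q] or [q + 1] by 4. *)
- move=> ok [nk en]; split=> nq; apply: toset => v;
    by rewrite has_cost_even_even; [apply: cond| | | |]; lia.
- move=> ek; split=> [[nk en]|nk]; last first.
    apply: toset => v; have -> : N = 3 * k.+1 - 1 by lia.
    by rewrite has_cost_even_odd_last; [apply: cond| |]; lia.
  (* The upper end is the larger of [K.+1 = k + 2] and [N - K + 3 = n - k]. *)
  split=> nk2; apply: toset => v; rewrite has_cost_even_odd; try lia.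
    by apply: cond; lia.
  by split=> [[vk ev]|->] /=; lia.
Qed.
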